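(* Let $p\in\mathbb{R}_m[\mathbf{x}]$ with $\mathbf{x}=(x_1,\dots,x_n)$, and let $r:=2^{nd}$ for some positive integer $d$ such that $r\ge m$. Let $Q:=[0,1]^n$ be described by $g_i:=x_i(1-x_i)$, $i=1,\dots,n$. Assume the following conjecture holds: for every even positive integer $N$, $\prod_{i=1}^N x_i+\frac{1}{N(N+2)}\in M_N(g_1,\dots,g_N)$. Then $p_{\min,Q}-p^{(r)}_{\mathrm{put},\mathbf{g}}\le\frac{3}{2}\frac{L(p)}{\log_2 r}\binom{m+1}{3}n^{m+1}+\frac{p_{\max,Q}-p_{\min,Q}}{r+2}$.
   Context: $\mathbb{R}_m[\mathbf{x}]$ is the set of real polynomials of degree at most $m$. $\Sigma[\mathbf{x}]$ denotes sums of squares; $M_r(\mathbf{g})=M_r(g_1,\dots,g_n):=\{\sigma_0+\sum_{i}\sigma_i g_i:\ \sigma_i\in\Sigma[\mathbf{x}],\ \deg\sigma_0\le r,\ \deg(\sigma_ig_i)\le r\}$. $p_{\min,Q}:=\min_{Q}p$, $p_{\max,Q}:=\max_Q p$, $p^{(r)}_{\mathrm{put},\mathbf{g}}:=\sup\{\mu: p-\mu\in M_r(\mathbf{g})\}$. Writing $p=\sum_{\mathbf{k}}p_{\mathbf{k}}\mathbf{x}^{\mathbf{k}}$, $L(p):=\max_{\mathbf{k}}|p_{\mathbf{k}}|\frac{\mathbf{k}!}{|\mathbf{k}|!}$ where $|\mathbf{k}|=\sum_ik_i$, $\mathbf{k}!=\prod_ik_i!$. *)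

(* Defs.v *)
From HB Require Import structures.
From mathcomp Require Import all_boot all_order all_algebra.
From mathcomp Require Import mpoly.
From mathcomp Require Import classical_sets reals.
Set Implicit Arguments. Unset Strict Implicit. Unset Printing Implicit Defensive.
Import Order.TTheory GRing.Theory Num.Theory.
Local Open Scope ring_scope.

Section Defs.
Variable R : realType.

(* total degree of p is at most r  (msize p = 1 + total degree, 0 for p = 0) *)
Definition deg_le (n : nat) (p : {mpoly R[n]}) (r : nat) : Prop :=
  (msize p <= r.+1)%N.

Definition is_sos (n : nat) (p : {mpoly R[n]}) : Prop :=
  exists s : seq {mpoly R[n]}, p = \sum_(q <- s) q ^+ 2.

Definition quadmod (n k r : nat) (g : 'I_k -> {mpoly R[n]}) (f : {mpoly R[n]}) : Prop :=
  exists (s0 : {mpoly R[n]}) (s : 'I_k -> {mpoly R[n]}),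
    [/\ is_sos s0, deg_le s0 r,
        (forall i, is_sos (s i) /\ deg_le (s i * g i) r)
      & f = s0 + \sum_(i < k) s i * g i].

Definition cube_gens (n : nat) : 'I_n -> {mpoly R[n]} :=
  fun i => 'X_i * (1 - 'X_i).

Definition unit_cube (n : nat) : set ('I_n -> R) :=
  [set x | forall i, 0 <= x i <= 1].
Arguments unit_cube : clear implicits.

Definition pmin (n : nat) (p : {mpoly R[n]}) : R :=
  inf ((fun x => p.@[x]) @` unit_cube n).
Definition pmax (n : nat) (p : {mpoly R[n]}) : R :=
  sup ((fun x => p.@[x]) @` unit_cube n).

Definition pput (n k r : nat) (g : 'I_k -> {mpoly R[n]}) (p : {mpoly R[n]}) : R :=
  sup [set mu : R | quadmod r g (p - mu%:MP)].

(* L(p) = max_k |p_k| k!/|k|!  (coefficients outside the support are 0) *)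
Definition Lnorm (n : nat) (p : {mpoly R[n]}) : R :=
  \big[Num.max/0]_(k <- msupp p)
     (`|p@_k| * (\prod_(i < n) (k i)`!)%:R / (mdeg k)`!%:R).

End Defs.
Arguments unit_cube {R} n.
Arguments cube_gens {R} n.

(* Main.v *)
(* Let B be the Bernstein operator of degree d in each variable.  The basis of B
   consists of products of nd factors x_i or 1 - x_i.  Substituting these factors,
   padded with 1's, for the variables of the conjectured identity with
   N = r = 2^(nd) puts each product plus 1/(r(r+2)) in M_r; since the binomial
   weights of the basis add up to 2^(nd) = r, this certifies
   B p - p_min + (p_max - p_min)/(r+2).  On the other hand B x^a is a convex
   combination of monomials x^b, b <= a, in which x^a has weight at least
   1 - binom(|a|,2)/d, and x^a + 1/(r(r+2)) and 1 - x^b lie in M_r.  Hence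
   p - B p + (1 + 1/(r(r+2))) sum_a |p_a| binom(|a|,2)/d lies in M_r, and the
   multinomial theorem bounds the sum by L(p) binom(m+1,3) n^m. *)
Require Import Defs.
From HB Require Import structures.
From mathcomp Require Import all_boot all_order all_algebra.
From mathcomp Require Import mpoly.
From mathcomp Require Import classical_sets reals.
From mathcomp Require Import ring lra zify.
Import Order.TTheory GRing.Theory Num.Theory.
Local Open Scope ring_scope.
Set Implicit Arguments. Unset Strict Implicit.

(** * Degree bounds, sums of squares and truncated quadratic modules *)

Section Quadmod.
Context {R : realType} {n : nat}.
Implicit Types (p q f : {mpoly R[n]}) (s : seq {mpoly R[n]}).

Lemma deg_le_trans p a b : deg_le p a -> (a <= b)%N -> deg_le p b.
Proof. by rewrite /deg_le => pa ab; apply: leq_trans pa _. Qed.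

Lemma deg_leC c a : deg_le (c%:MP : {mpoly R[n]}) a.
Proof. by rewrite /deg_le msizeC; case: (c != 0). Qed.

Lemma deg_leD p q a : deg_le p a -> deg_le q a -> deg_le (p + q) a.
Proof.
by rewrite /deg_le => pa qa; apply: leq_trans (msizeD_le _ _) _; rewrite geq_max pa.
Qed.

Lemma deg_leN p a : deg_le p a -> deg_le (- p) a.
Proof. by rewrite /deg_le msizeN. Qed.

Lemma deg_leZ c p a : deg_le p a -> deg_le (c *: p) a.
Proof. by rewrite /deg_le => pa; apply: leq_trans (msizeZ_le _ _) pa. Qed.

Lemma deg_leM p q a b : deg_le p a -> deg_le q b -> deg_le (p * q) (a + b).
Proof.
rewrite /deg_le => pa qb.
have [->|p0] := eqVneq p 0; first by rewrite mul0r msize0.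
have [->|q0] := eqVneq q 0; first by rewrite mulr0 msize0.
by rewrite msizeM// -ltnS prednK ?ltnS ?addn_gt0 ?lt0n ?msize_poly_eq0 ?p0//
  (leq_trans (leq_add pa qb))// addSn addnS.
Qed.

Lemma deg_leX p k a : deg_le p a -> deg_le (p ^+ k) (a * k).
Proof.
move=> pa; elim: k => [|k IH]; first by rewrite expr0 -mpolyC1; exact: deg_leC.
by rewrite exprS mulnS; exact: deg_leM.
Qed.

Lemma deg_leXU (i : 'I_n) : deg_le ('X_i : {mpoly R[n]}) 1.
Proof. by rewrite /deg_le msizeX mdeg1. Qed.

Lemma deg_le_sum (I : Type) (t : seq I) (P : pred I) (F : I -> {mpoly R[n]}) a :
  (forall i, P i -> deg_le (F i) a) -> deg_le (\sum_(i <- t | P i) F i) a.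
Proof.
move=> H; apply: (big_ind (fun p => deg_le p a)) => //.
- by rewrite -mpolyC0; exact: deg_leC.
- by move=> x y; exact: deg_leD.
Qed.

Lemma is_sos0 : is_sos (0 : {mpoly R[n]}).
Proof. by exists [::]; rewrite big_nil. Qed.

Lemma is_sosD p q : is_sos p -> is_sos q -> is_sos (p + q).
Proof. by move=> [s ->] [t ->]; exists (s ++ t); rewrite big_cat. Qed.

Lemma is_sos_sqr p : is_sos (p ^+ 2).
Proof. by exists [:: p]; rewrite big_seq1. Qed.

Lemma is_sosZ c p : 0 <= c -> is_sos p -> is_sos (c *: p).
Proof.
move=> c0 [s ->]; exists [seq Num.sqrt c *: q | q <- s].
rewrite big_map scaler_sumr; apply: eq_bigr => q _.
by rewrite exprZn sqr_sqrtr.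
Qed.

Lemma is_sosC c : 0 <= c -> is_sos (c%:MP : {mpoly R[n]}).
Proof.
move=> c0; rewrite -[c%:MP]mulr1 mul_mpolyC -(expr1n _ 2).
by apply: is_sosZ => //; exact: is_sos_sqr.
Qed.

Lemma is_sos_comp k (p : {mpoly R[k]}) (u : k.-tuple {mpoly R[n]}) :
  is_sos p -> is_sos (p \mPo u).
Proof.
move=> [s ->]; exists [seq v \mPo u | v <- s].
by rewrite big_map rmorph_sum; apply: eq_bigr => q _; rewrite rmorphXn.
Qed.

Lemma meval_sos_ge0 p (x : 'I_n -> R) : is_sos p -> 0 <= p.@[x].
Proof.
move=> [s ->]; rewrite rmorph_sum sumr_ge0// => q _.
by rewrite rmorphXn sqr_ge0.
Qed.

(** Keeps the degree bounds of a certificate intact when its variables are replaced by ['X_i],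
    [1 - 'X_i] or 1. *)
Lemma deg_le_comp k (p : {mpoly R[k]}) (u : k.-tuple {mpoly R[n]}) r :
  (forall i, deg_le (tnth u i) 1) -> deg_le p r -> deg_le (p \mPo u) r.
Proof.
move=> hu hp; rewrite comp_mpolyE big_seq; apply: deg_le_sum => m mp.
apply: deg_leZ; have {mp}/leq_trans/(_ hp) := msize_mdeg_lt mp.
rewrite ltnS; apply: deg_le_trans; rewrite mdegE.
apply: (big_ind2 (fun p a => deg_le p a)) => //.
- by rewrite -mpolyC1; exact: deg_leC.
- by move=> *; exact: deg_leM.
- by move=> i _; rewrite -[X in deg_le _ X]mul1n; exact: deg_leX.
Qed.

Section Generic.
Context {k : nat} (g : 'I_k -> {mpoly R[n]}) (r : nat).

Lemma quadmod_sos f : is_sos f -> deg_le f r -> quadmod r g f.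
Proof.
move=> sf df; exists f, (fun=> 0); split=> //.
  by move=> i; rewrite mul0r -mpolyC0; split; [exact: is_sos0|exact: deg_leC].
by rewrite big1 ?addr0// => i _; rewrite mul0r.
Qed.

Lemma quadmodC c : 0 <= c -> quadmod r g c%:MP.
Proof. by move=> c0; apply: quadmod_sos; [exact: is_sosC|exact: deg_leC]. Qed.

Lemma quadmodD f1 f2 : quadmod r g f1 -> quadmod r g f2 -> quadmod r g (f1 + f2).
Proof.
move=> [s0 [s [? ? hs ->]]] [t0 [t [? ? ht ->]]].
exists (s0 + t0), (fun i => s i + t i); split.
- exact: is_sosD.
- exact: deg_leD.
- move=> i; have [? ?] := hs i; have [? ?] := ht i.
  by split; [exact: is_sosD|rewrite mulrDl; exact: deg_leD].
- by rewrite addrACA -big_split; congr (_ + _); apply: eq_bigr => i _; rewrite mulrDl.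
Qed.

Lemma quadmodZ c f : 0 <= c -> quadmod r g f -> quadmod r g (c *: f).
Proof.
move=> c0 [s0 [s [? ? hs ->]]].
exists (c *: s0), (fun i => c *: s i); split.
- exact: is_sosZ.
- exact: deg_leZ.
- move=> i; have [? ?] := hs i.
  by split; [exact: is_sosZ|rewrite -scalerAl; exact: deg_leZ].
- rewrite scalerDr scaler_sumr; congr (_ + _).
  by apply: eq_bigr => i _; rewrite scalerAl.
Qed.

Lemma quadmod_sum (I : Type) (t : seq I) (P : pred I) (F : I -> {mpoly R[n]}) :
  (forall i, P i -> quadmod r g (F i)) -> quadmod r g (\sum_(i <- t | P i) F i).
Proof.
move=> H; apply: (big_ind (quadmod r g)) => //; last exact: quadmodD.
by rewrite -mpolyC0; exact: quadmodC.
Qed.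

Lemma quadmod_gen i q : is_sos q -> deg_le (q * g i) r -> quadmod r g (q * g i).
Proof.
move=> sq dq; exists 0, (fun j => if j == i then q else 0); split.
- exact: is_sos0.
- by rewrite -mpolyC0; exact: deg_leC.
- move=> j; case: eqP => [->//|_]; rewrite mul0r -mpolyC0.
  by split; [exact: is_sos0|exact: deg_leC].
- rewrite add0r (bigD1 i)//= eqxx big1 ?addr0// => j /negPf ->.
  by rewrite mul0r.
Qed.

End Generic.

Lemma quadmod_le k (g : 'I_k -> {mpoly R[n]}) a b f :
  (a <= b)%N -> quadmod a g f -> quadmod b g f.
Proof.
move=> ab [s0 [s [? ds hs ->]]]; exists s0, s; split=> //.
  exact: deg_le_trans ds ab.
by move=> i; have [? di] := hs i; split=> //; exact: deg_le_trans di ab.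
Qed.

Lemma quadmod_meval_ge0 k (g : 'I_k -> {mpoly R[n]}) r f (x : 'I_n -> R) :
  (forall i, 0 <= (g i).@[x]) -> quadmod r g f -> 0 <= f.@[x].
Proof.
move=> gx [s0 [s [ss _ hs ->]]].
rewrite mevalD raddf_sum addr_ge0 /= ?meval_sos_ge0// sumr_ge0// => i _.
have [sg _] := hs i; rewrite mevalM; apply: mulr_ge0; [exact: meval_sos_ge0|exact: gx].
Qed.

End Quadmod.

(** * Substitution as a ring morphism *)

Section CompMorphism.
Context {R : realType} {k n : nat} (u : k.-tuple {mpoly R[n]}).

Lemma comp_mpolyM (p q : {mpoly R[k]}) : (p * q) \mPo u = (p \mPo u) * (q \mPo u).
Proof. exact: rmorphM. Qed.

Lemma comp_mpoly_sum (I : Type) (t : seq I) (P : pred I) (F : I -> {mpoly R[k]}) :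
  (\sum_(i <- t | P i) F i) \mPo u = \sum_(i <- t | P i) (F i \mPo u).
Proof. exact: raddf_sum. Qed.

Lemma comp_mpoly_prod (I : Type) (t : seq I) (P : pred I) (F : I -> {mpoly R[k]}) :
  (\prod_(i <- t | P i) F i) \mPo u = \prod_(i <- t | P i) (F i \mPo u).
Proof. exact: rmorph_prod. Qed.

End CompMorphism.

(** * Membership in the quadratic module of the cube *)

Section Cube.
Context {R : realType} {n : nat}.
Implicit Types (f q : {mpoly R[n]}).

Definition cube_factor q := exists i : 'I_n, q = 'X_i \/ q = 1 - 'X_i.

Lemma deg_le_cube_factor q : cube_factor q -> deg_le q 1.
Proof.
move=> [i [->|->]]; first exact: deg_leXU.
apply: deg_leD; first by rewrite -mpolyC1; exact: deg_leC.
by apply: deg_leN; exact: deg_leXU.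
Qed.

(* Substitute the listed factors for the variables of the conjectured identity
   and 1 for the remaining ones; each x_j (1 - x_j) becomes a generator or 0. *)
Lemma quadmod_prod_factor N c (s : seq {mpoly R[n]}) :
  quadmod N (cube_gens N) (\prod_(i < N) 'X_i + (c : R)%:MP) ->
  {in s, forall q, cube_factor q} -> (size s <= N)%N ->
  quadmod N (cube_gens n) (\prod_(q <- s) q + c%:MP).
Proof.
move=> [s0 [t [ss0 ds0 ht E]]] hs sN.
pose u := [tuple nth 1 s i | i < N].
have hu i : tnth u i = 1 \/ cube_factor (tnth u i).
  rewrite tnth_mktuple; have [si|si] := ltnP i (size s).
    by right; apply: hs; exact: mem_nth.
  by left; rewrite nth_default.
have du i : deg_le (tnth u i) 1.
  by have [->|/deg_le_cube_factor//] := hu i; rewrite -mpolyC1; exact: deg_leC.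
have XU (i : 'I_N) : 'X_i \mPo u = tnth u i by rewrite comp_mpolyXU (tnth_nth 0).
have -> : \prod_(q <- s) q + c%:MP = (\prod_(i < N) 'X_i + c%:MP) \mPo u.
  rewrite comp_mpolyD comp_mpolyC comp_mpoly_prod; congr (_ + _).
  under [RHS]eq_bigr do rewrite XU tnth_mktuple.
  rewrite (big_nth 1) -(big_mkord xpredT (nth 1 s)) [RHS](big_cat_nat (leq0n _) sN)/=.
  rewrite [X in _ * X]big_nat [X in _ * X]big1 ?mulr1// => i /andP[si _].
  by rewrite nth_default.
rewrite E comp_mpolyD comp_mpoly_sum; apply: quadmodD.
  by apply: quadmod_sos; [exact: is_sos_comp|exact: deg_le_comp].
apply: quadmod_sum => i _; have [st dt] := ht i.
have := deg_le_comp du dt.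
rewrite comp_mpolyM /cube_gens comp_mpolyM comp_mpolyB comp_mpoly1 XU .
have [->|[j Ej]] := hu i.
  by rewrite subrr mulr0 mulr0 -mpolyC0 => _; exact: quadmodC.
have -> : tnth u i * (1 - tnth u i) = cube_gens n j.
  by rewrite /cube_gens; case: Ej => -> //; rewrite subKr mulrC.
by move=> D; apply: quadmod_gen => //; exact: is_sos_comp.
Qed.

Lemma deg_le_prodX (s : seq 'I_n) :
  deg_le (\prod_(i <- s) 'X_i : {mpoly R[n]}) (size s).
Proof.
rewrite -[X in deg_le _ X]sum1_size.
apply: (big_ind2 (fun p a => deg_le p a)) => [|*|j _].
- by rewrite -mpolyC1; exact: deg_leC.
- exact: deg_leM.
- exact: deg_leXU.
Qed.

(** Induction on the factors: peeling off x from xq leaves q^2 (1 - x^2), and 1 - x^2 = (1 - x)^2 +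
    2 x (1 - x) is a square plus twice a generator. *)
Lemma quadmod_one_sub_sqr (s : seq 'I_n) :
  quadmod (2 * size s) (cube_gens n) (1 - (\prod_(i <- s) 'X_i : {mpoly R[n]}) ^+ 2).
Proof.
elim: s => [|i s IH].
  by rewrite big_nil expr1n subrr -mpolyC0; exact: quadmodC.
rewrite big_cons /=; have dq := deg_le_prodX s.
set q := \prod_(i <- s) _ in IH dq *.
have d1 : deg_le (1 - 'X_i : {mpoly R[n]}) 1.
  by apply: deg_le_cube_factor; exists i; right.
have -> : 1 - ('X_i * q) ^+ 2 = (1 - q ^+ 2) + (q * (1 - 'X_i)) ^+ 2
    + (2%:R : R) *: (q ^+ 2 * cube_gens n i) :> {mpoly R[n]}.
  by rewrite scaler_nat /cube_gens; ring.
have dq2 : deg_le (q ^+ 2 * cube_gens n i) (2 * (size s).+1).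
  apply: (@deg_le_trans _ _ _ (size s * 2 + (1 + 1))); last by lia.
  apply: deg_leM; first exact: deg_leX.
  by apply: deg_leM => //; exact: deg_leXU.
apply: quadmodD; last first.
  by apply: quadmodZ => //; apply: quadmod_gen => //; exact: is_sos_sqr.
apply: quadmodD; first by apply: quadmod_le IH; rewrite mulnS leq_addl.
apply: quadmod_sos; first exact: is_sos_sqr.
rewrite mulnC; apply: deg_leX; rewrite -addn1; exact: deg_leM.
Qed.

Lemma mpolyX_seq (a : 'X_{1..n}) :
  exists2 s : seq 'I_n, size s = mdeg a & 'X_[a] = \prod_(i <- s) 'X_i :> {mpoly R[n]}.
Proof.
exists (flatten [seq nseq (a i) i | i <- enum 'I_n]).
  rewrite size_flatten /shape -map_comp sumnE big_map mdegE big_enum.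
  by apply: eq_bigr => i _ /=; rewrite size_nseq.
rewrite big_flatten big_map big_enum mpolyXE_id.
by apply: eq_bigr => i _; rewrite big_nseq -Monoid.iteropE.
Qed.

(** Split the monomial into two halves u, v and write 1 - uv as half of (1 - u^2) + (1 - v^2) + (u -
    v)^2. The longer half may have (|a| + 1)/2 factors, so its square may have degree |a| + 1; for
    odd |a| this is still at most r because r is even. *)
Lemma quadmod_one_sub_mpolyX r (a : 'X_{1..n}) : ~~ odd r -> (mdeg a <= r)%N ->
  quadmod r (cube_gens n) (1 - 'X_[a] : {mpoly R[n]}).
Proof.
move=> er ar; have [s sa ->] := mpolyX_seq a.
pose h := (size s)./2.
have sh : size (take h s) = h by rewrite size_takel// /h; lia.
have hr : (2 * size (take h s) <= r)%N by rewrite sh /h; lia.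
have hr' : (2 * size (drop h s) <= r)%N by rewrite size_drop /h; lia.
rewrite -(cat_take_drop h s) big_cat /=.
have := quadmod_le hr (quadmod_one_sub_sqr (take h s)).
have := quadmod_le hr' (quadmod_one_sub_sqr (drop h s)).
have du := deg_le_prodX (take h s); have dv := deg_le_prodX (drop h s).
set u := \prod_(i <- take h s) _ in du *; set v := \prod_(i <- drop h s) _ in dv *.
move=> Qv Qu.
have -> : 1 - u * v =
    (2%:R^-1 : R) *: ((1 - u ^+ 2) + (1 - v ^+ 2) + (u - v) ^+ 2) :> {mpoly R[n]}.
  apply: (@scalerI _ _ (2%:R : R)); first by rewrite pnatr_eq0.
  by rewrite scalerA divff ?pnatr_eq0// scale1r scaler_nat; ring.
apply: quadmodZ; first by rewrite invr_ge0 ler0n.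
apply: quadmodD; first exact: quadmodD.
apply: quadmod_sos; first exact: is_sos_sqr.
have m : (maxn (size (take h s)) (size (drop h s)) * 2 <= r)%N by lia.
apply: deg_le_trans m; apply: deg_leX; apply: deg_leD.
  by apply: deg_le_trans du _; rewrite leq_maxl.
by apply: deg_leN; apply: deg_le_trans dv _; rewrite leq_maxr.
Qed.
End Cube.

(** * Stirling numbers of the second kind and binomial moments *)

Fixpoint stirling (k j : nat) : nat :=
  match k, j with
  | 0, 0 => 1
  | 0, _.+1 => 0
  | _.+1, 0 => 0
  | k'.+1, j'.+1 => stirling k' j' + j'.+1 * stirling k' j'.+1
  end.

Lemma stirling_small k j : (k < j)%N -> stirling k j = 0%N.
Proof.
elim: k j => [|k IH] [|j] //= kj.
by rewrite !IH ?muln0 ?(ltnW kj).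
Qed.

Lemma stirlingnn k : stirling k k = 1%N.
Proof. by elim: k => [|k IH] //=; rewrite IH stirling_small ?muln0. Qed.

(** Multiplying a falling factorial by y = (y - j) + j reproduces the recurrence of [stirling]. Any
    [K] above [k] is allowed, so that different exponents can share one summation range. *)
Lemma expn_stirling k K y : (k < K)%N ->
  (y ^ k = \sum_(j < K) stirling k j * y ^_ j)%N.
Proof.
elim: k K => [|k IH] [|K]// kK.
  by rewrite big_ord_recl big1 ?expn0.
rewrite expnS (IH K.+1) 1?ltnW// big_ord_recl [RHS]big_ord_recl add0n.
rewrite mulnDr big_distrr /=.
(* The truncated difference y - j is harmless: for y < j the falling factorial [y ^_ j] is 0. *)
have step j : (y * (y ^_ j) = y ^_ j.+1 + j * y ^_ j)%N.
  rewrite ffactnSr mulnC; have [jy|yj] := leqP j y.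
    by rewrite [(j * _)%N]mulnC -mulnDr subnK.
  by rewrite ffact_small// mul0n muln0.
have -> : (y * (stirling k 0 * y ^_ 0) = stirling k 0 * y ^_ 1)%N.
  by rewrite mulnCA step mul0n addn0.
under eq_bigr do rewrite mulnCA step mulnDr.
rewrite big_split addnA /=.
under [RHS]eq_bigr do rewrite /bump /= add1n /= mulnDl.
rewrite big_split /=; congr (_ + _)%N; last first.
  by apply: eq_bigr => i _; rewrite /bump /= add1n mulnCA mulnA.
case: K kK {IH} => // K kK; rewrite [RHS]big_ord_recl; congr (_ + _)%N.
rewrite big_ord_recr /= [X in (_ + X)%N](_ : _ = 0)%N ?addn0.
  by apply: eq_bigr.
by rewrite stirling_small ?mul0n// /bump /= add1n.
Qed.

(* The factorial moments of the binomial distribution. *)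
Lemma sum_ffact_bernstein (A : comPzRingType) (x : A) d j :
  \sum_(h < d.+1) (h ^_ j * 'C(d, h))%:R * (x ^+ h * (1 - x) ^+ (d - h))
    = (d ^_ j)%:R * x ^+ j.
Proof.
elim: j d => [|j IH] d.
  rewrite ffactn0 expr0 mulr1; transitivity ((1 - x + x) ^+ d).
    rewrite exprDn; apply: eq_bigr => h _; rewrite ffactn0 mul1n.
    by rewrite [x ^+ h * _]mulrC mulr_natl.
  by rewrite subrK expr1n.
rewrite big_ord_recl /= ffact0n mul0n !mul0r add0r.
case: d => [|d]; first by rewrite big_ord0 ffact0n mul0r.
(* The absorption identity (h+1) C(d+1, h+1) = (d+1) C(d, h) pulls out (d+1) x and lowers both d and
   j by one. *)
transitivity (d.+1%:R * x *
   \sum_(h < d.+1) (h ^_ j * 'C(d, h))%:R * (x ^+ h * (1 - x) ^+ (d - h))).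
  rewrite big_distrr; apply: eq_bigr => h _ /=.
  rewrite /bump /= add1n ffactSS subSS exprS.
  have -> : (h.+1 * h ^_ j * 'C(d.+1, h.+1) = d.+1 * (h ^_ j * 'C(d, h)))%N.
    by rewrite mulnAC -mul_bin_diag /= -mulnA [('C(_, _) * _)%N]mulnC.
  by rewrite natrM; ring.
by rewrite IH ffactSS natrM exprS; ring.
Qed.

(** * Coefficients of the Bernstein image of a univariate power *)

Section BernsteinCoefficients.
Context {R : realType}.

(* The Bernstein operator of degree [d] maps [X^k] to
   [\sum_j bern_coef d k j *: X^j]. *)
Definition bern_coef (d k j : nat) : R := (stirling k j * d ^_ j)%:R / d%:R ^+ k.

Lemma bern_coef_ge0 d k j : 0 <= bern_coef d k j.
Proof. by rewrite divr_ge0// ?exprn_ge0. Qed.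

Lemma bern_coef_small d k j : (k < j)%N -> bern_coef d k j = 0.
Proof. by move=> kj; rewrite /bern_coef stirling_small// mul0n mul0r. Qed.

Lemma sum_bern_coef d k K : (0 < d)%N -> (k < K)%N -> \sum_(j < K) bern_coef d k j = 1.
Proof.
move=> d0 kK; rewrite -mulr_suml -natr_sum -expn_stirling// natrX divff//.
by rewrite expf_neq0// pnatr_eq0 -lt0n.
Qed.

(** The diagonal coefficient is the product of the factors 1 - i/d for i < k, and the numbers i/d
    sum to C(k, 2)/d. The upper bound holds since the coefficients are nonnegative with sum 1. *)
Lemma bern_coef_diag_ge d k : (0 < d)%N ->
  1 - 'C(k, 2)%:R / d%:R <= bern_coef d k k <= 1.
Proof.
move=> d0; have d0' : (0 : R) < d%:R by rewrite ltr0n.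
apply/andP; split; last first.
  rewrite -(sum_bern_coef d0 (ltnSn k)).
  by rewrite big_ord_recr /= lerDr sumr_ge0// => *; exact: bern_coef_ge0.
rewrite /bern_coef stirlingnn mul1n; elim: k => [|k IH].
  by rewrite bin0n mul0r subr0 ffactn0 expr0 divr1.
rewrite binS bin1 natrD ffactnSr natrM exprSr invfM mulrACA.
set t := (d ^_ k)%:R / d%:R ^+ k in IH *.
have t1 : t <= 1.
  rewrite ler_pdivrMr ?exprn_gt0// mul1r -natrX ler_nat.
  by elim: (k) => // j IHj; rewrite ffactnSr expnSr leq_mul// leq_subr.
have t0 : 0 <= t by rewrite divr_ge0// exprn_ge0.
(* For k > d the natural difference is 0 while 1 - k/d is negative, so an inequality remains. *)
have kd : 1 - k%:R / d%:R <= (d - k)%:R / d%:R :> R.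
  rewrite -[X in X - _](divff (lt0r_neq0 d0')) -mulrBl ler_pM2r ?invr_gt0//.
  have [?|?] := leqP k d; first by rewrite natrB.
  by apply: le_trans (ler0n _ _); rewrite subr_le0 ler_nat ltnW.
have k0 : 0 <= k%:R / d%:R :> R by rewrite divr_ge0.
rewrite mulrDl; have := ler_wpM2l t0 kd.
have : 0 <= (1 - t) * (k%:R / d%:R) by rewrite mulr_ge0// subr_ge0.
lra.
Qed.

End BernsteinCoefficients.

(** * Product bounds, multinomial coefficients and L(p) *)

Section Monomials.
Context {R : realType} {n : nat}.

(** Pairs inside one of several disjoint blocks are among the pairs of their union. *)
Lemma sum_bin2_le (I : finType) (a : I -> nat) :
  (\sum_i 'C(a i, 2) <= 'C(\sum_i a i, 2))%N.
Proof.
apply: (big_ind2 (fun x y => (x <= 'C(y, 2))%N)) => //.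
move=> x1 y1 x2 y2 h1 h2; apply: leq_trans (leq_add h1 h2) _.
rewrite !bin2; nia.
Qed.

(** The Weierstrass product inequality. *)
Lemma one_sub_sum_le_prod (I : finType) (u : I -> R) :
  (forall i, 0 <= u i <= 1) -> 1 - \sum_i (1 - u i) <= \prod_i u i.
Proof.
move=> hu.
(* The bounds 0 and 1 on the partial products are carried along because the inductive step uses (1 -
   x1)(1 - x2) >= 0. *)
suff [] : 0 <= \prod_i u i <= 1 /\ 1 - \sum_i (1 - u i) <= \prod_i u i by [].
apply: (big_ind2 (fun (x y : R) => 0 <= x <= 1 /\ 1 - y <= x)).
- by rewrite ler01 lexx subr0.
- move=> x1 y1 x2 y2 [/andP[x10 x11] h1] [/andP[x20 x21] h2].
  by rewrite mulr_ge0// mulr_ile1//; split=> //; nra.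
- by move=> i _; rewrite hu; split=> //; rewrite opprB addrC subrK.
Qed.

(** The left side is the total weight of the monomials other than X^a in the Bernstein image of
    X^a. *)
Lemma prod_bern_coef_diag_ge d (a : 'X_{1..n}) : (0 < d)%N ->
  1 - \prod_i bern_coef d (a i) (a i) <= 'C(mdeg a, 2)%:R / d%:R :> R.
Proof.
move=> d0; rewrite lerBlDl -lerBlDr.
apply: le_trans (one_sub_sum_le_prod _); last first.
  by move=> i; have /andP[_ ->] := @bern_coef_diag_ge R d (a i) d0; rewrite bern_coef_ge0.
rewrite lerD2l lerN2; apply: (@le_trans _ _ (\sum_i 'C(a i, 2)%:R / d%:R)).
  by apply: ler_sum => i _; have /andP[? _] := @bern_coef_diag_ge R d (a i) d0;
    rewrite lerBlDl -lerBlDr.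
rewrite -mulr_suml ler_pM2r ?invr_gt0 ?ltr0n// -natr_sum ler_nat mdegE.
exact: sum_bin2_le.
Qed.

Definition multinomial (a : 'X_{1..n}) : R :=
  (mdeg a)`!%:R / (\prod_(i < n) (a i)`!)%:R.

Lemma multinomial_ge0 a : 0 <= multinomial a.
Proof. by rewrite divr_ge0. Qed.

(** The multinomial theorem. In the step to k + 1, the last factor ['X_i] contributes the fraction
    a_i/(k+1) of the coefficient, and these fractions sum to 1. *)
Lemma mcoeff_sum_pow k (a : 'X_{1..n}) :
  ((\sum_i 'X_i : {mpoly R[n]}) ^+ k)@_a = if mdeg a == k then multinomial a else 0.
Proof.
elim: k a => [|k IH] a.
  rewrite expr0 mcoeff1 mdeg_eq0; case: eqP => // ->.
  rewrite /multinomial mdeg0 big1 ?divr1// => i _.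
  by rewrite mnm0E.
rewrite exprSr big_distrr raddf_sum /=.
have E (i : 'I_n) : (((\sum_j 'X_j : {mpoly R[n]}) ^+ k) * 'X_i)@_a =
    if mdeg a == k.+1 then multinomial a * (a i)%:R / k.+1%:R else 0.
  have [ai|ai] := posnP (a i).
    rewrite ai mulr0 mul0r if_same; apply/eqP; rewrite mcoeff_eq0.
    rewrite (perm_mem (msuppMX _ _)); apply/mapP => -[b _ /(congr1 (fun c : 'X_{1..n} => c i))].
    by rewrite ai mnmDE mnm1E eqxx.
  have -> : a = (U_(i) + (a - U_(i)))%MM.
    by rewrite addmC submK// lep1mP -lt0n.
  set b := (a - U_(i))%MM.
  rewrite mcoeffMX IH mdegD mdeg1 add1n eqSS; case: eqP => // bk.
  rewrite /multinomial mdegD mdeg1 add1n factS bk.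
  rewrite (bigD1 i)//= [in RHS](bigD1 i)//= mnmDE mnm1E eqxx add1n factS.
  have -> : (\prod_(j < n | j != i) ((U_(i) + b)%MM j)`! = \prod_(j < n | j != i) (b j)`!)%N.
    by apply: eq_bigr => j /negPf ji; rewrite mnmDE mnm1E eq_sym ji add0n.
  rewrite !natrM; field.
  rewrite !nat1r !pnatr_eq0 -!lt0n !fact_gt0 prodn_gt0 ?andbT//.
  by move=> j; rewrite fact_gt0.
under eq_bigr do rewrite E.
case: eqP => ak; last by rewrite big1.
by rewrite -mulr_suml -mulr_sumr -natr_sum -mdegE ak mulfK ?pnatr_eq0.
Qed.

(** The terms on the left are coefficients of the sum [G] of w_k (x_1 + ... + x_n)^k. As all
    coefficients of [G] are nonnegative, their partial sum is at most the value of [G] at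
    (1,...,1). *)
Lemma sum_multinomial_le (w : nat -> R) m (s : seq 'X_{1..n}) :
  (forall k, 0 <= w k) -> uniq s -> {in s, forall a, mdeg a <= m}%N ->
  \sum_(a <- s) w (mdeg a) * multinomial a <= \sum_(k < m.+1) w k * n%:R ^+ k.
Proof.
move=> w0 us hs.
pose G := \sum_(k < m.+1) w k *: (\sum_i 'X_i : {mpoly R[n]}) ^+ k.
have GE a : (mdeg a <= m)%N -> G@_a = w (mdeg a) * multinomial a.
  move=> am; rewrite raddf_sum (bigD1 (Ordinal (am : mdeg a < m.+1)%N))//=.
  rewrite mcoeffZ mcoeff_sum_pow eqxx big1 ?addr0// => k ka.
  rewrite mcoeffZ mcoeff_sum_pow ifN ?mulr0//.
  by apply: contraNneq ka => E; apply/eqP/val_inj.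
have G0 a : 0 <= G@_a.
  rewrite raddf_sum sumr_ge0// => k _; rewrite /= mcoeffZ mcoeff_sum_pow mulr_ge0//.
  by case: ifP => // _; exact: multinomial_ge0.
have G1 : G.@[fun=> 1] = \sum_(k < m.+1) w k * n%:R ^+ k.
  rewrite raddf_sum; apply: eq_bigr => k _ /=; rewrite mevalZ rmorphXn raddf_sum /=.
  by under eq_bigr do rewrite mevalXU; rewrite sumr_const card_ord.
rewrite -G1 mevalE.
rewrite [leRHS](eq_bigr (fun a => G@_a)); last first.
  by move=> a _; rewrite big1 ?mulr1// => i _; rewrite expr1n.
rewrite big_seq; under eq_bigr => a /hs am do rewrite -GE//.
rewrite -big_seq (bigID (mem (msupp G)))/= addrC big1 ?add0r; last first.
  by move=> a /memN_msupp_eq0.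
rewrite -big_filter; apply: (@le_trans _ _ (\sum_(a <- msupp G | a \in s) G@_a)).
  rewrite -[leRHS]big_filter (perm_big [seq a <- msupp G | a \in s])//=.
  apply: uniq_perm; rewrite ?filter_uniq// => a.
  by rewrite !mem_filter andbC.
by rewrite [leRHS](bigID (mem s))/= lerDl sumr_ge0.
Qed.

Lemma sum_bin2 m : (\sum_(k < m.+1) 'C(k, 2) = 'C(m.+1, 3))%N.
Proof.
elim: m => [|m IH]; first by rewrite big_ord1.
by rewrite big_ord_recr /= IH [RHS]binS.
Qed.

Lemma Lnorm_coef (p : {mpoly R[n]}) a : a \in msupp p ->
  `|p@_a| <= Lnorm p * multinomial a.
Proof.
move=> ap; rewrite -ler_pdivrMr; last first.
  rewrite divr_gt0 ?ltr0n ?fact_gt0// prodn_gt0// => i.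
  exact: fact_gt0.
rewrite /multinomial invf_div mulrA /Lnorm.
exact: (le_bigmax_seq 0 a xpredT
  (fun k : 'X_{1..n} => `|p@_k| * (\prod_(i < n) (k i)`!)%:R / (mdeg k)`!%:R) ap).
Qed.

Lemma Lnorm_ge0 (p : {mpoly R[n]}) : 0 <= Lnorm p.
Proof.
rewrite /Lnorm; elim/big_ind: _ => // [x y x0 y0|a _]; first by rewrite le_max x0.
by rewrite divr_ge0// mulr_ge0.
Qed.

(** Bound |p_a| by L(p) times the multinomial coefficient, sum by degree k to get C(k, 2) n^k,
    replace n^k by n^m, and finish with the hockey-stick identity. *)
Lemma sum_coef_bin2_le (p : {mpoly R[n]}) m : (0 < n)%N -> deg_le p m ->
  \sum_(a <- msupp p) `|p@_a| * 'C(mdeg a, 2)%:R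
    <= Lnorm p * 'C(m.+1, 3)%:R * n%:R ^+ m.
Proof.
move=> n0 pm.
apply: (@le_trans _ _ (Lnorm p * \sum_(a <- msupp p) 'C(mdeg a, 2)%:R * multinomial a)).
  rewrite mulr_sumr big_seq [leRHS]big_seq; apply: ler_sum => a ap.
  by rewrite [_ * multinomial _]mulrC mulrA ler_wpM2r// Lnorm_coef.
rewrite -mulrA ler_wpM2l ?Lnorm_ge0//.
apply: le_trans (@sum_multinomial_le (fun k => 'C(k, 2)%:R) m (msupp p) _ _ _) _ => //.
  by move=> a /msize_mdeg_lt/leq_trans/(_ pm).
rewrite -sum_bin2 natr_sum mulr_suml; apply: ler_sum => k _.
by rewrite ler_wpM2l// ler_weXn2l ?ler1n// -ltnS.
Qed.

End Monomials.

(** * The multivariate Bernstein operator *)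

Section Bernstein.
Context {R : realType} {n : nat}.
Implicit Types (p : {mpoly R[n]}) (d : nat).

(** Expanding h^k in falling factorials turns the sum into factorial moments of the binomial
    distribution. The algebra [A] is general so that [x] can be a variable ['X_i]. *)
Lemma univariate_bernstein (A : comAlgType R) (x : A) d k K : (k < K)%N ->
  \sum_(h < d.+1) ((h%:R / d%:R) ^+ k * 'C(d, h)%:R) *: (x ^+ h * (1 - x) ^+ (d - h))
    = \sum_(j < K) bern_coef d k j *: x ^+ j :> A.
Proof.
move=> kK; pose b h := x ^+ h * (1 - x) ^+ (d - h).
transitivity (\sum_(h < d.+1) \sum_(j < K)
    ((stirling k j)%:R / d%:R ^+ k : R) *: ((h ^_ j * 'C(d, h))%:R * b h)).
  apply: eq_bigr => h _; rewrite expr_div_n -(natrX _ h) (expn_stirling h kK).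
  rewrite natr_sum !mulr_suml scaler_suml; apply: eq_bigr => j _.
  rewrite -/(b h) [(_ * _)%:R * b h]mulr_natl -scaler_nat scalerA.
  by congr (_ *: _); rewrite !natrM; ring.
rewrite exchange_big; apply: eq_bigr => j _ /=.
rewrite -scaler_sumr sum_ffact_bernstein [_ * x ^+ _]mulr_natl -scaler_nat scalerA.
by rewrite /bern_coef natrM mulrAC.
Qed.

Definition bern_basis d (h : {ffun 'I_n -> 'I_d.+1}) : {mpoly R[n]} :=
  \prod_i ('X_i ^+ h i * (1 - 'X_i) ^+ (d - h i)).

(** Kept apart from [bern_basis] because the certificate adds [eps] to each unweighted product; the
    weights then multiply [eps], and their total matters. *)
Definition bern_weight d (h : {ffun 'I_n -> 'I_d.+1}) : R := \prod_i 'C(d, h i)%:R.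

Definition bern_node d (h : {ffun 'I_n -> 'I_d.+1}) : 'I_n -> R :=
  fun i => (h i)%:R / d%:R.

Definition bernstein d p : {mpoly R[n]} :=
  \sum_(h : {ffun 'I_n -> 'I_d.+1}) (p.@[bern_node h] * bern_weight h) *: bern_basis h.

Lemma bern_weight_ge0 d (h : {ffun 'I_n -> 'I_d.+1}) : 0 <= bern_weight h.
Proof. exact: prodr_ge0. Qed.

Lemma sum_bern_weight d :
  \sum_(h : {ffun 'I_n -> 'I_d.+1}) bern_weight h = (2 ^ (n * d))%:R.
Proof.
rewrite -(bigA_distr_bigA (fun (i : 'I_n) (j : 'I_d.+1) => 'C(d, j)%:R)) /= prodr_const card_ord.
rewrite -natr_sum -natrX mulnC expnM (Pascal 1 1).
by under [in RHS]eq_bigr do rewrite !exp1n !muln1.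
Qed.

Lemma sum_bern_basis d :
  \sum_(h : {ffun 'I_n -> 'I_d.+1}) bern_weight h *: bern_basis h = 1.
Proof.
under eq_bigr do rewrite -scaler_prod.
rewrite -(bigA_distr_bigA
  (fun i (j : 'I_d.+1) => 'C(d, j)%:R *: ('X_i ^+ j * (1 - 'X_i) ^+ (d - j)))) /=.
rewrite big1// => i _; rewrite -[RHS](expr0 ('X_i : {mpoly R[n]})) -[RHS]mul1r.
rewrite -[1 in RHS](_ : (d ^_ 0)%:R = 1)// -sum_ffact_bernstein.
by apply: eq_bigr => h _; rewrite ffactn0 mul1n mulr_natl scaler_nat.
Qed.

(** On a monomial the sum over the grid factors into one univariate sum per variable; multiplying
    out their expansions gives a sum over exponent vectors. *)
Lemma bernsteinX d (a : 'X_{1..n}) K : (forall i, a i < K)%N ->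
  bernstein d 'X_[a] = \sum_(f : {ffun 'I_n -> 'I_K})
    (\prod_i bern_coef d (a i) (f i)) *: 'X_[ [multinom (f i : nat) | i < n] ].
Proof.
move=> aK; rewrite /bernstein.
under eq_bigr do rewrite mevalX -big_split -scaler_prod.
rewrite -(bigA_distr_bigA (fun i (j : 'I_d.+1) => ((j%:R / d%:R) ^+ a i * 'C(d, j)%:R) *:
   ('X_i ^+ j * (1 - 'X_i) ^+ (d - j)))) /=.
under eq_bigr => i _ do rewrite (univariate_bernstein _ _ (aK i)).
rewrite bigA_distr_bigA; apply: eq_bigr => f _; rewrite scaler_prod; congr (_ *: _).
by rewrite mpolyXE_id; apply: eq_bigr => i _; rewrite mnmE.
Qed.

Lemma bernsteinE d p : bernstein d p = \sum_(a <- msupp p) p@_a *: bernstein d 'X_[a].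
Proof.
rewrite /bernstein; under [RHS]eq_bigr do rewrite scaler_sumr.
rewrite exchange_big; apply: eq_bigr => h _ /=.
under [RHS]eq_bigr do rewrite scalerA mulrA.
by rewrite -scaler_suml -mulr_suml mevalE; congr ((_ * _) *: _);
  apply: eq_bigr => a _; rewrite mevalX.
Qed.

Lemma bern_basis_seq d (h : {ffun 'I_n -> 'I_d.+1}) : exists s : seq {mpoly R[n]},
  [/\ bern_basis h = \prod_(q <- s) q, {in s, forall q, cube_factor q}
    & (size s <= n * d)%N].
Proof.
exists (flatten [seq nseq (h i) 'X_i ++ nseq (d - h i) (1 - 'X_i) | i <- enum 'I_n]).
split.
- rewrite big_flatten big_map big_enum; apply: eq_bigr => i _.
  by rewrite big_cat /= !big_nseq -!Monoid.iteropE.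
- move=> q /flattenP[s /mapP[i _ ->]]; rewrite mem_cat !mem_nseq.
  by case/orP => /andP[_ /eqP ->]; exists i; [left|right].
- rewrite size_flatten /shape -map_comp sumnE big_map big_enum /=.
  rewrite -[X in (_ <= X * _)%N]card_ord -sum_nat_const; apply: leq_sum => i _.
  by rewrite size_cat !size_nseq subnKC// -ltnS.
Qed.

End Bernstein.

(** * Certificates for p - B p and for B p minus a lower bound *)

Section Certificate.
Context {R : realType} {n r : nat} (eps : R).
Implicit Types (p : {mpoly R[n]}).
Hypothesis r_even : ~~ odd r.
Hypothesis eps_ge0 : 0 <= eps.
Hypothesis quadmod_prodX :
  quadmod r (cube_gens r) (\prod_(i < r) 'X_i + eps%:MP).

Let Q (f : {mpoly R[n]}) := quadmod r (cube_gens n) f.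

Lemma quadmod_mpolyX_eps (a : 'X_{1..n}) : (mdeg a <= r)%N -> Q ('X_[a] + eps%:MP).
Proof.
move=> ar; have [s sa Ea] := @mpolyX_seq R n a.
have -> : 'X_[a] = \prod_(q <- [seq 'X_i | i <- s]) q :> {mpoly R[n]} by rewrite big_map.
apply: quadmod_prod_factor => //; last by rewrite size_map sa.
by move=> q /mapP[i _ ->]; exists i; left.
Qed.

(** For c >= 0, add X^a + eps and 1 - X^b; a negative c exchanges the roles of a and b. *)
Lemma quadmod_sub_mpolyX c (a b : 'X_{1..n}) : (mdeg a <= r)%N -> (mdeg b <= r)%N ->
  Q (c *: ('X_[a] - 'X_[b]) + (`|c| * (1 + eps))%:MP).
Proof.
wlog c0 : c a b / 0 <= c => [H ar br|].
  have [c0|c0] := leP 0 c; first exact: H.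
  by rewrite -opprB scalerN -scaleNr -normrN; apply: H; rewrite // oppr_ge0 ltW.
move=> ar br; rewrite ger0_norm// mpolyCM mul_mpolyC -scalerDr.
have -> : 'X_[a] - 'X_[b] + (1 + eps)%:MP = ('X_[a] + eps%:MP) + (1 - 'X_[b]) :> {mpoly R[n]}.
  by rewrite mpolyCD mpolyC1; ring.
apply: quadmodZ => //; apply: quadmodD; first exact: quadmod_mpolyX_eps.
exact: quadmod_one_sub_mpolyX.
Qed.

(* [B X^a] is a convex combination of the monomials [X^b] with [b <= a] in which
   [X^a] has weight at least [1 - 'C(|a|, 2) / d]. *)
Lemma quadmod_sub_bernsteinX d c (a : 'X_{1..n}) : (0 < d)%N -> (mdeg a <= r)%N ->
  Q (c *: ('X_[a] - bernstein d 'X_[a])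
     + (`|c| * (1 + eps) * ('C(mdeg a, 2)%:R / d%:R))%:MP).
Proof.
move=> d0 ar.
have aK i : (a i < (mdeg a).+1)%N by rewrite ltnS mdegE (bigD1 i)//= leq_addr.
pose f0 : {ffun 'I_n -> 'I_(mdeg a).+1} := [ffun i => Ordinal (aK i)].
pose w (f : {ffun 'I_n -> 'I_(mdeg a).+1}) : R := \prod_i bern_coef d (a i) (f i).
pose M (f : {ffun 'I_n -> 'I_(mdeg a).+1}) := [multinom (f i : nat) | i < n].
have w0 f : 0 <= w f by apply: prodr_ge0 => i _; exact: bern_coef_ge0.
have Sw : \sum_f w f = 1.
  rewrite -(bigA_distr_bigA (fun (i : 'I_n) (j : 'I_(mdeg a).+1) => bern_coef d (a i) j)) /=.
  by rewrite big1// => i _; rewrite sum_bern_coef.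
have Mf0 : M f0 = a by apply/mnmP => i; rewrite mnmE ffunE.
have wf0 : 1 - w f0 <= 'C(mdeg a, 2)%:R / d%:R.
  rewrite /w; under eq_bigr do rewrite ffunE.
  exact: prod_bern_coef_diag_ge.
have Sw0 : \sum_(f | f != f0) w f = 1 - w f0.
  by have := Sw; rewrite (bigD1 f0)//= => <-; rewrite [_ + \sum_(_ | _) _]addrC addrK.
pose C := `|c| * (1 + eps).
have C0 : 0 <= C by rewrite mulr_ge0// addr_ge0.
(* The term of [f0] vanishes because [M f0] is a. The others have total weight [1 - w f0], and the
   last constant is the slack in [wf0]. *)
have -> : c *: ('X_[a] - bernstein d 'X_[a]) + (C * ('C(mdeg a, 2)%:R / d%:R))%:MP =
    \sum_(f | f != f0) w f *: (c *: ('X_[a] - 'X_[M f]) + C%:MP)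
    + (C * ('C(mdeg a, 2)%:R / d%:R - (1 - w f0)))%:MP.
  have -> : bernstein d 'X_[a] = \sum_f w f *: 'X_[M f] by exact: bernsteinX.
  have {1}-> : 'X_[a] = \sum_f w f *: 'X_[a] :> {mpoly R[n]}.
    by rewrite -scaler_suml Sw scale1r.
  rewrite -sumrB scaler_sumr.
  rewrite (bigD1 f0)//= Mf0 subrr scaler0 add0r.
  have -> : C * ('C(mdeg a, 2)%:R / d%:R) = \sum_(f | f != f0) w f * C
      + C * ('C(mdeg a, 2)%:R / d%:R - (1 - w f0)).
    by rewrite -mulr_suml Sw0; ring.
  rewrite mpolyCD addrA raddf_sum -big_split; congr (_ + _); apply: eq_bigr => f _ /=.
  by rewrite -scalerBr [RHS]scalerDr mpolyCM mul_mpolyC !scalerA [c * _]mulrC.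
apply: quadmodD; last by apply: quadmodC; rewrite mulr_ge0// subr_ge0.
apply: quadmod_sum => f _; have [wf|wf] := eqVneq (w f) 0.
  by rewrite wf scale0r -mpolyC0; exact: quadmodC.
apply: quadmodZ => //; apply: quadmod_sub_mpolyX => //.
(* A nonzero weight forces f i <= a i for every i, hence |M f| <= |a|. *)
apply: leq_trans ar; rewrite !mdegE; apply: leq_sum => i _; rewrite mnmE leqNgt.
by apply: contraNN wf => fa; rewrite /w (bigD1 i)//= bern_coef_small ?mul0r.
Qed.

Lemma quadmod_sub_bernstein d p : (0 < d)%N -> deg_le p r ->
  Q (p - bernstein d p + ((1 + eps) / d%:R *
       \sum_(a <- msupp p) `|p@_a| * 'C(mdeg a, 2)%:R)%:MP).
Proof.
move=> d0 pr; rewrite {1}[p]mpolyE bernsteinE -sumrB mulr_sumr raddf_sum -big_split.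
rewrite big_seq; apply: quadmod_sum => a /msize_mdeg_lt/leq_trans/(_ pr) ar /=.
rewrite -scalerBr.
have -> : (1 + eps) / d%:R * (`|p@_a| * 'C(mdeg a, 2)%:R) =
    `|p@_a| * (1 + eps) * ('C(mdeg a, 2)%:R / d%:R) by ring.
exact: quadmod_sub_bernsteinX.
Qed.

(** The coefficients p(node) - lo are nonnegative, so each basis product may be raised by [eps].
    This costs at most [eps] (hi - lo) per unit of weight; what is left over is a nonnegative
    constant. *)
Lemma quadmod_bernstein d p (lo hi : R) : (n * d <= r)%N ->
  (forall h : {ffun 'I_n -> 'I_d.+1}, lo <= p.@[bern_node h] <= hi) ->
  Q (bernstein d p - lo%:MP + (eps * (2 ^ (n * d))%:R * (hi - lo))%:MP).
Proof.
move=> ndr hp.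
have -> : bernstein d p - lo%:MP + (eps * (2 ^ (n * d))%:R * (hi - lo))%:MP =
  \sum_(h : {ffun 'I_n -> 'I_d.+1})
    (((p.@[bern_node h] - lo) * bern_weight h) *: (bern_basis h + eps%:MP)
     + (eps * bern_weight h * (hi - p.@[bern_node h]))%:MP).
  rewrite big_split -raddf_sum /=.
  have -> : lo%:MP = \sum_(h : {ffun 'I_n -> 'I_d.+1})
      (lo * bern_weight h) *: bern_basis h :> {mpoly R[n]}.
    under eq_bigr do rewrite -scalerA.
    by rewrite -scaler_sumr sum_bern_basis -mul_mpolyC mulr1.
  under [in RHS]eq_bigr do rewrite scalerDr.
  rewrite big_split /= -[RHS]addrA; congr (_ + _).
    by rewrite /bernstein -sumrB; apply: eq_bigr => h _; rewrite -scalerBl mulrBl.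
  rewrite -sum_bern_weight mulr_sumr mulr_suml.
  under [X in _ = X + _]eq_bigr do rewrite -mul_mpolyC -mpolyCM.
  rewrite -raddf_sum -raddfD -big_split; congr (_ %:MP).
  by apply: eq_bigr => h _ /=; ring.
apply: quadmod_sum => h _; have /andP[lo_p p_hi] := hp h.
apply: quadmodD; last first.
  by apply: quadmodC; rewrite mulr_ge0 ?subr_ge0// mulr_ge0// bern_weight_ge0.
apply: quadmodZ; first by rewrite mulr_ge0 ?subr_ge0// bern_weight_ge0.
have [s [-> hs ss]] := @bern_basis_seq R n d h.
by apply: quadmod_prod_factor => //; exact: leq_trans ss ndr.
Qed.

End Certificate.

(** * Finiteness of the extrema on the cube and of the bound [pput] *)

Section Bounds.
Context {R : realType} {n : nat}.
Implicit Types (p : {mpoly R[n]}) (x : 'I_n -> R).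

(** Supplies the boundedness without which [inf] and [sup] in [pmin] and [pmax] would carry no
    information. *)
Lemma norm_meval_cube p x : unit_cube n x -> `|p.@[x]| <= \sum_(a <- msupp p) `|p@_a|.
Proof.
move=> x01; rewrite mevalE; apply: le_trans (ler_norm_sum _ _ _) _.
apply: ler_sum => a _; rewrite normrM ler_piMr// normr_prod prodr_ile1// => i _.
have /andP[x0 x1] := x01 i.
by rewrite normr_ge0 normrX exprn_ile1// ger0_norm.
Qed.

Lemma unit_cube0 : unit_cube n (fun=> 0 : R).
Proof. by move=> i; rewrite lexx ler01. Qed.

Lemma pmin_le p x : unit_cube n x -> pmin p <= p.@[x].
Proof.
move=> x01; apply: ge_inf; last by exists x.
exists (- \sum_(a <- msupp p) `|p@_a|) => _ [y y01 <-].
by have := norm_meval_cube p y01; rewrite ler_norml => /andP[].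
Qed.

Lemma pmax_ge p x : unit_cube n x -> p.@[x] <= pmax p.
Proof.
move=> x01; apply: ub_le_sup; last by exists x.
exists (\sum_(a <- msupp p) `|p@_a|) => _ [y y01 <-].
by have := norm_meval_cube p y01; rewrite ler_norml => /andP[].
Qed.

Lemma pmin_le_pmax p : pmin p <= pmax p.
Proof. exact: le_trans (pmin_le p unit_cube0) (pmax_ge p unit_cube0). Qed.

Lemma pput_ge r p mu : quadmod r (cube_gens n) (p - mu%:MP) ->
  mu <= pput r (cube_gens n) p.
Proof.
move=> Hmu; apply: ub_le_sup => //.
(* All generators vanish at the origin, so p(0) bounds every feasible value. *)
exists (p.@[fun=> 0]) => nu /(quadmod_meval_ge0 (x := fun=> 0)).
rewrite mevalB mevalC subr_ge0; apply=> i.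
by rewrite /cube_gens mevalM mevalXU mul0r.
Qed.

Lemma unit_cube_bern_node d (h : {ffun 'I_n -> 'I_d.+1}) : (0 < d)%N ->
  unit_cube n (bern_node h : 'I_n -> R).
Proof.
move=> d0 i; rewrite /bern_node divr_ge0//= ler_pdivrMr ?ltr0n// mul1r ler_nat.
by rewrite -ltnS.
Qed.

End Bounds.

(** * Assembly of the error bound *)

Theorem theorem7 (R : realType) (n m d : nat) (p : {mpoly R[n]})
  (hp : deg_le p m) (hd : (0 < d)%N) (hrm : (m <= 2 ^ (n * d))%N)
  (conj : forall N : nat, (0 < N)%N -> ~~ odd N ->
     quadmod N (cube_gens N)
       (\prod_(i < N) 'X_i + (1 / (N * (N + 2))%:R : R)%:MP)) :
  let r := (2 ^ (n * d))%N in
  pmin p - pput r (cube_gens n) p <=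
    3%:R / 2%:R * (Lnorm p / (n * d)%:R) * ('C(m.+1, 3))%:R * n%:R ^+ m.+1
    + (pmax p - pmin p) / (r + 2)%:R.
Proof.
lazy zeta; set r := (2 ^ (n * d))%N; set bound := (X in _ <= X).
rewrite lerBlDl -lerBlDr; apply: pput_ge.
(* For n = 0, r = 1 is odd and the conjecture does not apply. Here p is constant, and pmin <= p(0)
   with a nonnegative [bound] gives a constant certificate. *)
have [n0|n_gt0] := posnP n.
  have pC : p = (p@_0)%:MP.
    apply/mpolyP => a; suff -> : a = 0%MM by rewrite mcoeffC eqxx mulr1.
    by apply/mnmP => -[i lti]; have := lti; rewrite [X in (_ < X)%N]n0.
  have p0 : p.@[fun=> 0] = p@_0 by rewrite {1}pC mevalC.
  rewrite {1}pC -mpolyCB; apply: quadmodC.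
  rewrite -p0 opprB addrCA addr_ge0 ?subr_ge0 ?pmin_le//; last exact: unit_cube0.
  rewrite /bound addr_ge0 ?divr_ge0// ?subr_ge0 ?pmin_le_pmax//.
  by rewrite !mulr_ge0 ?invr_ge0 ?Lnorm_ge0 ?exprn_ge0 ?ler0n.
have r_even : ~~ odd r by rewrite oddX orbF muln_eq0 negb_or -!lt0n n_gt0 hd.
have r_ge2 : (2 <= r)%N by rewrite -[X in (X <= _)%N]expn1 leq_exp2l// muln_gt0 n_gt0.
have r_gt0 : (0 < r)%N by apply: leq_trans r_ge2.
pose eps : R := 1 / (r * (r + 2))%:R.
have eps_ge0 : 0 <= eps by rewrite divr_ge0.
(* Origin of the factor 3/2 in the theorem: it bounds 1 + [eps]. *)
have eps_le : eps <= 1 / 2%:R.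
  by rewrite /eps !div1r lef_pV2 ?posrE ?ltr0n ?ler_nat ?muln_gt0 ?r_gt0 ?addn_gt0//; nia.
have Q1 := @quadmod_sub_bernstein R n r eps r_even eps_ge0 (conj r r_gt0 r_even) d p hd
  (deg_le_trans hp hrm).
have ndr : (n * d <= r)%N by rewrite ltnW// ltn_expl.
have nodes h : pmin p <= p.@[@bern_node R n d h] <= pmax p.
  by rewrite pmin_le ?pmax_ge//; exact: unit_cube_bern_node.
have Q2 := @quadmod_bernstein R n r eps eps_ge0 (conj r r_gt0 r_even) d p _ _ ndr nodes.
set c1 : R := (1 + eps) / _ * _ in Q1; set c2 : R := _ * (_ - _) in Q2.
have -> : p - (pmin p - bound)%:MP = (p - bernstein d p + c1%:MP)
    + (bernstein d p - (pmin p)%:MP + c2%:MP) + (bound - c1 - c2)%:MP.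
  by rewrite !mpolyCB; ring.
apply: quadmodD; first exact: quadmodD.
apply: quadmodC.
(* The total weight 2^(nd) is r itself, and r [eps] = 1/(r + 2). *)
have -> : c2 = (pmax p - pmin p) / (r + 2)%:R.
  rewrite /c2 /eps -/r natrM; field.
  by rewrite pnatr_eq0 -lt0n r_gt0 -natrD pnatr_eq0 addn2.
rewrite /bound addrAC addrK subr_ge0.
have d_gt0 : (0 : R) < d%:R by rewrite ltr0n.
(* Since log_2 r = nd, one factor n of n^(m+1) cancels, leaving the 1/d of the Bernstein
   estimate. *)
have -> : 3%:R / 2%:R * (Lnorm p / (n * d)%:R) * ('C(m.+1, 3))%:R * n%:R ^+ m.+1 =
    3%:R / 2%:R / d%:R * (Lnorm p * ('C(m.+1, 3))%:R * n%:R ^+ m).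
  rewrite natrM exprS; field.
  by rewrite !pnatr_eq0 -!lt0n n_gt0 hd.
rewrite /c1; apply: ler_pM.
- by rewrite divr_ge0// addr_ge0.
- by apply: sumr_ge0 => a _; rewrite mulr_ge0.
- by rewrite ler_pM2r ?invr_gt0//; lra.
- exact: sum_coef_bin2_le.
Qed.
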